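(* Let $n\ge 2$, let $A\in\mathbb C^{n\times n}$ be a reciprocal matrix, and suppose that its numerical range $W(A)$ is an elliptical disk. Let $P_n(\zeta,\tau)$ be the polynomial associated with $A$ (defined in the context). Then $P_n(\zeta,\tau)$ is divisible by $\zeta-(x\tau+z)$ for some $x,z\in\mathbb R$ such that $\sqrt{z\pm x}$ are the lengths of the half-axes of $W(A)$. Equivalently, for these $x,z$, $P_n(x\tau+z,\tau)=0$ for all $\tau$.
   Context: The numerical range of $A\in\mathbb C^{n\times n}$ is $W(A)=\{\langle Ax,x\rangle:\ x\in\mathbb C^n,\ \|x\|=1\}$. A reciprocal matrix is a tridiagonal matrix $A\in\mathbb C^{n\times n}$ with zero main diagonal, superdiagonal entries $b_1,\dots,b_{n-1}$ and subdiagonal entries $c_1,\dots,c_{n-1}$ satisfying $b_jc_j=1$ for all $j$. Write $\operatorname{Re}M=(M+M^* )/2$. The NR generating polynomial of $A$ is $P_A(\lambda,\theta)=\det(\operatorname{Re}(e^{i\theta}A)-\lambda I)$. For a reciprocal matrix, with $\zeta=\lambda^2$ and $\tau=\cos(2\theta)$, one has $P_A(\lambda,\theta)=P_n(\zeta,\tau)$ if $n$ is even and $P_A(\lambda,\theta)=-\lambda P_n(\zeta,\tau)$ if $n$ is odd, where $P_n$ is a polynomial in $\zeta$ and $\tau$, monic of degree $\lfloor n/2\rfloor$ in $\zeta$; this defines $P_n$. *)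

(* Defs.v *)
From HB Require Import structures.
From mathcomp Require Import all_boot all_order all_algebra.
From mathcomp Require Export complex.
From mathcomp Require Import sesquilinear spectral ring zify.
From mathcomp Require Import classical_sets reals trigo.

Set Implicit Arguments.
Unset Strict Implicit.
Unset Printing Implicit Defensive.

Import Order.TTheory GRing.Theory Num.Theory.

Local Open Scope ring_scope.
Local Open Scope complex_scope.
Local Open Scope sesquilinear_scope.
Local Open Scope classical_set_scope.

(* (x ^t* *m A *m x) 0 0 is <Ax, x>, and (x ^t* *m x) 0 0 is |x|^2. *)
Definition numerical_range (R : realType) (n : nat) (A : 'M[R[i]]_n) :
    set R[i] :=
  [set w | exists2 x : 'cV[R[i]]_n,
             (x ^t* *m x) 0 0 = 1 & w = (x ^t* *m A *m x) 0 0].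

Definition reciprocal (R : realType) (n : nat) (A : 'M[R[i]]_n) : Prop :=
  (forall i j : 'I_n,
     val j != (val i).+1 -> val i != (val j).+1 -> A i j = 0) /\
  (forall i j : 'I_n, val j = (val i).+1 -> A i j * A j i = 1).

Definition re_mx (R : realType) (n : nat) (M : 'M[R[i]]_n) : 'M[R[i]]_n :=
  2^-1 *: (M + M ^t*).

Definition expi (R : realType) (t : R) : R[i] := cos t +i* sin t.

Definition NR_generating (R : realType) (n : nat) (A : 'M[R[i]]_n)
    (lambda theta : R) : R[i] :=
  \det (re_mx (expi theta *: A) - (lambda%:C)%:M).

(* A polynomial in (zeta, tau) is an element of {poly {poly R}}: the outer
   variable is zeta, the inner one is tau. *)
Definition eval2 (R : realType) (P : {poly {poly R}}) (zeta tau : R) : R :=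
  P.[zeta%:P].[tau].

Definition is_NR_poly (R : realType) (n : nat) (A : 'M[R[i]]_n)
    (P : {poly {poly R}}) : Prop :=
  [/\ P \is monic, size P = (n./2).+1 &
      forall lambda theta : R,
        NR_generating A lambda theta =
          (if odd n then - lambda else 1)%:C
          * (eval2 P (lambda ^+ 2) (cos (theta *+ 2)))%:C].

Lemma det_tridiagonal (K : comNzRingType) (n : nat) (f : nat -> nat -> K) :
  (forall i, f 0 i.+2 = 0) -> (forall i, f i.+2 0 = 0) ->
  \det (\matrix_(i < n.+2, j < n.+2) f i j) =
    f 0 0 * \det (\matrix_(i < n.+1, j < n.+1) f i.+1 j.+1)
    - f 0 1%N * f 1%N 0 * \det (\matrix_(i < n, j < n) f i.+2 j.+2).
Proof.
move=> f0 f0'.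
rewrite (expand_det_row _ ord0) 2!big_ord_recl [X in _ + (_ + X)]big1 ?addr0; last first.
  by move=> i _; rewrite !mxE /= f0 mul0r.
congr (_ + _).
  rewrite /cofactor /= addn0 expr0 mul1r mxE; congr (_ * \det _).
  by apply/matrixP=> i j; rewrite !mxE.
rewrite !mxE /cofactor /= /bump /= expr1 mulN1r mulrN -mulrA; congr (- (_ * _)).
rewrite (expand_det_col _ ord0) big_ord_recl [X in _ + X]big1 ?addr0; last first.
  by move=> i _; rewrite !mxE /= f0' mul0r.
rewrite /cofactor /= addn0 expr0 mul1r !mxE /=; congr (_ * \det _).
by apply/matrixP=> i j; rewrite !mxE.
Qed.

(* Continuant recurrence for the characteristic polynomial of the trailing
   blocks, with a k = (|b_k|^2 + |c_k|^2) / 2: the product of the two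
   off-diagonal entries of Re (e^(i theta) A) in position k is
   (a k + tau) / 2. *)
Fixpoint NR_rec (R : realType) (a : nat -> R) (n : nat) (k : nat) :
    {poly {poly R}} :=
  match n with
  | n'.+1 =>
    match n' with
    | m.+1 => (if odd m then 1 else 'X) * NR_rec a n' k.+1
              - ('X + (a k)%:P)%:P * ((2^-1)%:P)%:P * NR_rec a m k.+2
    | 0 => 1
    end
  | 0 => 1
  end.

Lemma NR_recSS (R : realType) (a : nat -> R) m k :
  NR_rec a m.+2 k = (if odd m then 1 else 'X) * NR_rec a m.+1 k.+1
              - ('X + (a k)%:P)%:P * ((2^-1)%:P)%:P * NR_rec a m k.+2.
Proof. by []. Qed.

Lemma NR_rec_monic (R : realType) (a : nat -> R) (n : nat) k :
  (NR_rec a n k \is monic) /\ size (NR_rec a n k) = n./2.+1.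
Proof.
elim/ltn_ind: n k => -[|[|m]] IH k; rewrite ?monic1 ?size_poly1 //.
rewrite NR_recSS.
have [m1 s1] := IH m.+1 (ltnSn _) k.+1.
have [m0 s0] := IH m (ltnW (ltnSn _)) k.+2.
set p := (if _ then _ else _) * _; set q := _ * NR_rec a m _.
have sp : size p = (m./2).+2.
  rewrite /p; case: ifP => om; first by rewrite mul1r s1 /= uphalf_half om.
  by rewrite size_Mmonic // ?polyX_eq0 // size_polyX s1 /= uphalf_half om.
have mp : p \is monic by rewrite /p; case: ifP => _; rewrite ?mul1r // monicMl // monicX.
have sq : (size (- q) < size p)%N.
  rewrite size_polyN sp ltnS /q -polyCM; apply: leq_trans (size_polyMleq _ _) _.
  by rewrite s0 addnS /= -[leqRHS]add1n leq_add2r size_polyC_leq1.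
by rewrite monicE lead_coefDl // size_polyDl // sp (monicP mp).
Qed.

Lemma NR_poly_exists (R : realType) (n : nat) (A : 'M[R[i]]_n) :
  reciprocal A -> exists P, is_NR_poly A P.
Proof.
case: n A => [|n] A [A0 A1].
  by exists 1; split; rewrite ?monic1 ?size_poly1 // => l t; rewrite /NR_generating det_mx00 /eval2 !hornerE.
pose b k := if (k < n)%N then A (inord k) (inord k.+1) else 1.
pose c k := if (k < n)%N then A (inord k.+1) (inord k) else 1.
have bc k : b k * c k = 1.
  rewrite /b /c; case: ifP => kn; last by rewrite mulr1.
  by apply: A1; rewrite /= !inordK // ltnW.
pose a k : R := complex.Re ((b k * conjc (b k) + c k * conjc (c k)) / 2%:R).
have aE k : (a k)%:C = (b k * conjc (b k) + c k * conjc (c k)) / 2%:R.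
  rewrite /a; case: (b k) (c k) => [b1 b2] [c1 c2]; simpc.
  by rewrite /GRing.inv /= ; simpc; congr (_ +i* _); ring.
exists (NR_rec a n.+1 0); have [m s] := NR_rec_monic a n.+1 0; split=> // l t.
have [e eE] : exists e, e = expi t by exists (expi t).
have conjM (x y : R[i]) : conjc (x * y) = conjc x * conjc y := rmorphM conjc x y.
pose f i j : R[i] := if i == j then - l%:C else if j == i.+1 then 2^-1 * (e * b i + conjc (e * c i))
   else if i == j.+1 then 2^-1 * (e * c j + conjc (e * b j)) else 0.
have -> : NR_generating A l t = \det (\matrix_(i < n.+1, j < n.+1) f (0 + i)%N (0 + j)%N).
  congr (\det _); apply/matrixP=> i j; rewrite !mxE -eE !add0n /f -val_eqE /=.
  have d i' : A i' i' = 0.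
    by apply: A0; rewrite neq_ltn ltnSn.
  case: eqP => [/val_inj ->|/eqP ij]; first by rewrite d mulr0 rmorph0 addr0 mulr0 add0r mulr1n.
  rewrite mulr0n subr0.
  have [ji|nji] := eqVneq (val j) (val i).+1.
    have lt : (i < n)%N by rewrite -ltnS -ji ltn_ord.
    by rewrite /b /c lt -ji !inord_val.
  have [ji|nij] := eqVneq (val i) (val j).+1.
    have lt : (j < n)%N by rewrite -ltnS -ji ltn_ord.
    by rewrite /b /c lt -ji !inord_val.
  by rewrite !A0 // mulr0 rmorph0 addr0 mulr0.
have e2 : e ^+ 2 + (conjc e) ^+ 2 = 2 * (cos (t *+ 2))%:C.
  rewrite eE /expi !expr2; simpc; rewrite mulr2n cosD.
  by apply/eqP; rewrite eq_complex /=; apply/andP; split; apply/eqP; ring.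
have e1 : e * conjc e = 1.
  rewrite eE /expi; simpc; rewrite -!expr2 cos2Dsin2.
  by apply/eqP; rewrite eq_complex /= eqxx /=; apply/eqP; ring.
have gE k : f k k.+1 * f k.+1 k = (2^-1 * (cos (t *+ 2) + a k))%:C.
  have n1 : (k == k.+1) = false by rewrite eqn_leq ltnn andbF.
  have n2 : (k.+1 == k) = false by rewrite eqn_leq ltnn.
  have n3 : (k == k.+2) = false by rewrite eqn_leq [(k.+2 <= k)%N]ltnNge leqnSn andbF.
  have C1 : (2^-1 * (cos (t *+ 2) + a k))%:C = 2^-1 * ((cos (t *+ 2))%:C + (a k)%:C).
    by rewrite rmorphM rmorphD fmorphV rmorph_nat.
  rewrite /f n1 n2 n3 !eqxx C1 aE.
  have bc' : conjc (b k) * conjc (c k) = 1 by rewrite -conjM bc; exact: (rmorph1 conjc).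
    rewrite !conjM.
  have -> : (cos (t *+ 2))%:C = 2^-1 * (e ^+ 2 + (conjc e) ^+ 2) by rewrite e2 mulKf // pnatr_eq0.
  clear f; move: e1 bc' (bc k); clear e2 eE; set e' := conjc e; set b' := conjc (b k); set c' := conjc (c k).
  move: e e' (b k) b' (c k) c' => {}e {}e' b0 b' c0 c' E B' B.
  have -> : 2^-1 * (e * b0 + e' * c') * (2^-1 * (e * c0 + e' * b')) =
     2^-1 * 2^-1 * (e ^+ 2 * (b0 * c0) + e' ^+ 2 * (b' * c') + (e * e') * (b0 * b' + c0 * c')) by ring.
  by rewrite E B B' !mulr1 mul1r; ring.
have D0 k : f k k = - l%:C by rewrite /f eqxx.
have fz k h : f k (k + h.+2)%N = 0.
  by rewrite /f; do 3!(case: eqP => [?|_]; first lia).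
have fz' k h : f (k + h.+2)%N k = 0.
  by rewrite /f; do 3!(case: eqP => [?|_]; first lia).
suff D m' k : \det (\matrix_(i < m', j < m') f (k + i)%N (k + j)%N) =
   (if odd m' then - l else 1)%:C * (eval2 (NR_rec a m' k) (l ^+ 2) (cos (t *+ 2)))%:C by exact: D.
elim/ltn_ind: m' k => -[|[|m']] IH k.
- by rewrite det_mx00 /eval2 !hornerE.
- rewrite det_mx11 !mxE !addn0 D0 /eval2 !hornerE. by rewrite /= (rmorphN (real_complex R)).
rewrite (@det_tridiagonal _ m' (fun i j => f (k + i)%N (k + j)%N)); first last.
- by move=> i; rewrite addn0 fz'.
- by move=> i; rewrite addn0 fz.
have shift p q : \det (\matrix_(i < p, j < p) f (k + (q + i))%N (k + (q + j))%N) =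
   \det (\matrix_(i < p, j < p) f (k + q + i)%N (k + q + j)%N).
  by congr (\det _); apply/matrixP => i j; rewrite !mxE !addnA.
rewrite (shift m'.+1 1%N) (shift m' 2%N) !IH // !addn0 addn1 addn2 D0 gE.

rewrite NR_recSS /eval2 !hornerE /= -!rmorphM -rmorphN -!rmorphM -rmorphB /=.
by congr (_%:C); case: (odd m') => /=; rewrite !hornerE; ring.
Qed.

Lemma poly_inf_roots (K : idomainType) (d : {poly K}) (g : nat -> K) :
  injective g -> (forall k, d.[g k] = 0) -> d = 0.
Proof.
move=> ginj dg; apply: (@roots_geq_poly_eq0 _ d [seq g k | k <- iota 0 (size d)]).
- by apply/allP=> _ /mapP[k _ ->]; apply/rootP.
- by rewrite map_inj_uniq // iota_uniq.
- by rewrite size_map size_iota.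
Qed.

Lemma NR_poly_unique (R : realType) (n : nat) (A : 'M[R[i]]_n)
    (P Q : {poly {poly R}}) :
  is_NR_poly A P -> is_NR_poly A Q -> P = Q.
Proof.
move=> [_ _ hP] [_ _ hQ].
have key (z t : R) : 0 < z -> -1 <= t <= 1 -> eval2 P z t = eval2 Q z t.
  move=> z0 t1; pose l := Num.sqrt z; pose th := acos t / 2.
  have := hP l th; rewrite hQ -mulr_natr mulfVK ?pnatr_eq0 // acosK //.
  rewrite /l sqr_sqrtr ?ltW // => /mulfI h; symmetry; apply: complexI; apply: h.
  by case: (odd n); rewrite (fmorph_eq0 (real_complex R)) ?oppr_eq0 ?oner_eq0 // sqrtr_eq0 -ltNge.
apply/eqP; rewrite -subr_eq0; apply/eqP.
apply: (@poly_inf_roots _ _ (fun k => (k.+1%:R : R)%:P)) => [k h /polyC_inj/eqP|k].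
  by rewrite eqr_nat eqSS => /eqP.
apply: (@poly_inf_roots _ _ (fun k => (k.+1%:R : R)^-1)) => [h h' /invr_inj/eqP|h].
  by rewrite eqr_nat eqSS => /eqP.
have := key k.+1%:R h.+1%:R^-1; rewrite /eval2 !hornerE => -> //; first by rewrite subrr.
rewrite invf_le1 ?ltr0Sn // ler1n andbT.
by apply: le_trans (_ : 0 <= _); rewrite ?invr_ge0 // lerN10.
Qed.

(* The ellipse may degenerate to a segment (q = 0), which is what happens for
   Hermitian A; u is the direction of the major axis. *)
Definition elliptical_disk (R : realType) (c u : R[i]) (p q : R) : set R[i] :=
  [set w | exists s t : R,
             s ^+ 2 + t ^+ 2 <= 1 /\ w = c + u * ((p * s) +i* (q * t))].

Definition is_elliptical_disk (R : realType) (W : set R[i]) (p q : R) : Prop :=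
  [/\ 0 < p, 0 <= q, q <= p &
      exists c u : R[i], `|u| = 1 /\ W = elliptical_disk c u p q].

(* Main.v *)
Require Import Defs.
From mathcomp Require Import all_boot all_order all_algebra.
From mathcomp Require Import reals.
From mathcomp Require Import sesquilinear ring lra.
From mathcomp Require Import classical_sets trigo.

Set Implicit Arguments.
Unset Strict Implicit.
Unset Printing Implicit Defensive.

Import Order.TTheory GRing.Theory Num.Theory.

Local Open Scope ring_scope.

(** Why the theorem is true.

    Let [W = W(A)] and let [h theta] be the maximum of [Re (e^(i theta) w)] for
    [w] in [W], i.e. the support function of [W] up to the sign of the angle.
    Since [Re (e^(i theta) <Ax, x>)] is the quadratic form of the Hermitian
    matrix [Re (e^(i theta) A)], the number [h theta] is the largest eigenvalue
    of that matrix, so it is a root of [P_A (., theta)]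
    ([NR_generating_support]); conversely every real root is the value of
    [Re (e^(i theta) w)] at some point [w] of [W] ([NR_generating_root]).

    As [P_A] depends on [theta] only through [cos (2 theta)], so does [h]
    ([support_eq]).  In particular [h (theta + pi) = h theta] and
    [h (- theta) = h theta].  For an ellipse with centre [c], axis direction
    [u = a + i b] and half-axes [p], [q] one computes
      [h theta = Re (e^(i theta) c) + sqrt (p^2 C^2 + q^2 S^2)],
    where [C + i S = e^(i theta) u] ([support_elliptical_disk]).  The first
    symmetry forces [c = 0]; the second forces [a b (p^2 - q^2) = 0], i.e. the
    axes lie along the coordinate axes unless the ellipse is a circle.  Then
      [h^2 = X cos^2 theta + Y sin^2 theta = z + x cos (2 theta)]
    with [{X, Y} = {p^2, q^2}], [z + x = X] and [z - x = Y]
    ([squared_support_affine]).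

    So [P_n (x tau + z, tau) = 0] as soon as [tau = cos (2 theta)] and
    [x tau + z <> 0], the latter because of the factor [- lambda] for odd [n].
    This covers infinitely many [tau], hence the polynomial
    [P_n (x tau + z, tau)] in [tau] is zero, and the factor theorem over
    [{poly R}] gives the divisor [zeta - (x tau + z)]. *)

(** * Quadratic forms of complex matrices *)

Local Open Scope sesquilinear_scope.

Definition qform (C : numClosedFieldType) n (M : 'M[C]_n) (x : 'cV[C]_n) : C :=
  (x ^t* *m M *m x) 0 0.

Section QuadraticForm.
Variable C : numClosedFieldType.

Lemma adjmxM m n k (A : 'M[C]_(m, n)) (B : 'M_(n, k)) :
  (A *m B) ^t* = B ^t* *m A ^t*.
Proof. by rewrite trmx_mul map_mxM. Qed.

Lemma adjmxK m n (A : 'M[C]_(m, n)) : (A ^t*) ^t* = A.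
Proof. by apply/matrixP => i j; rewrite !mxE conjCK. Qed.

Lemma adjmxZ m n a (A : 'M[C]_(m, n)) : (a *: A) ^t* = a^* *: A ^t*.
Proof. by apply/matrixP => i j; rewrite !mxE rmorphM. Qed.

Lemma adjmxB m n (A B : 'M[C]_(m, n)) : (A - B) ^t* = A ^t* - B ^t*.
Proof. by apply/matrixP => i j; rewrite !mxE rmorphB. Qed.

Lemma qform_adj n (M : 'M[C]_n) x : qform (M ^t*) x = (qform M x)^*.
Proof.
rewrite /qform.
have -> : ((x ^t* *m M *m x) 0 0)^* = ((x ^t* *m M *m x) ^t*) 0 0.
  by rewrite !mxE.
by rewrite !adjmxM adjmxK mulmxA.
Qed.

Lemma qformD n (M N : 'M[C]_n) x : qform (M + N) x = qform M x + qform N x.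
Proof. by rewrite /qform mulmxDr mulmxDl mxE. Qed.

Lemma qformZ n a (M : 'M[C]_n) x : qform (a *: M) x = a * qform M x.
Proof. by rewrite /qform -scalemxAr -scalemxAl mxE. Qed.

Lemma qform_scalar n a (x : 'cV[C]_n) : qform a%:M x = a * (x ^t* *m x) 0 0.
Proof. by rewrite -scalemx1 qformZ /qform mulmx1. Qed.

Lemma qform_scale n (M : 'M[C]_n) a x : qform M (a *: x) = `|a| ^+ 2 * qform M x.
Proof.
rewrite /qform adjmxZ -!scalemxAl -scalemxAr !mxE normCK.
by rewrite mulrCA mulrA.
Qed.

Lemma dot_ge0 n (x : 'cV[C]_n) : 0 <= (x ^t* *m x) 0 0.
Proof. by rewrite mxE sumr_ge0 // => i _; rewrite !mxE mulrC mul_conjC_ge0. Qed.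

Lemma dot_eq0 n (x : 'cV[C]_n) : ((x ^t* *m x) 0 0 == 0) = (x == 0).
Proof.
apply/eqP/eqP => [|->]; last by rewrite mulmx0 mxE.
rewrite mxE => /psumr_eq0P h; apply/colP => i; rewrite [RHS]mxE.
have := h _ i isT; rewrite !mxE mulrC => /(_ _)/eqP; rewrite mul_conjC_eq0.
by move=> /(_ _)/eqP -> // j _; rewrite !mxE mulrC mul_conjC_ge0.
Qed.

Lemma exists_unit_multiple n (x : 'cV[C]_n) : x != 0 ->
  exists a : C, a != 0 /\ ((a *: x) ^t* *m (a *: x)) 0 0 = 1.
Proof.
rewrite -dot_eq0 => x0; exists (sqrtC ((x ^t* *m x) 0 0))^-1.
have s0 : 0 <= sqrtC ((x ^t* *m x) 0 0) by rewrite sqrtC_ge0 dot_ge0.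
split; first by rewrite invr_eq0 sqrtC_eq0.
have := qform_scale 1%:M (sqrtC ((x ^t* *m x) 0 0))^-1 x.
rewrite /qform !mulmx1 => ->.
by rewrite ger0_norm ?invr_ge0 // exprVn sqrtCK mulVf.
Qed.

(** Otherwise [v = M x] would be a descent direction: with [N = v^* v] and
    [r = v^* M v], the form at [x - t v] is [t (t r - 2 N)], which is negative
    for small positive [t]. *)
Lemma psd_isotropic_ker n (M : 'M[C]_n) x :
  M ^t* = M -> (forall y, 0 <= qform M y) -> qform M x = 0 -> M *m x = 0.
Proof.
move=> herm pos q0; set v := M *m x.
apply/eqP; rewrite -dot_eq0; set N := _ 0 0; apply/negP => /negP N0.
have Ngt0 : 0 < N by rewrite lt0r N0 dot_ge0.
pose r := qform M v; have r0 : 0 <= r by exact: pos.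
(* Any [t] with [0 < t] and [t r < 2 N] would do; this one also covers [r = 0]. *)
pose t := N / (r + N); have rN : 0 < r + N by rewrite ltr_wpDl.
have t0 : 0 < t by rewrite divr_gt0.
have tC : t^* = t by rewrite conj_Creal // gtr0_real.
suff E : qform M (x - t *: v) = t * (t * r - 2 * N).
  have := pos (x - t *: v); rewrite E pmulr_rge0 // lt_geF //.
  rewrite /t mulrAC subr_lt0 ltr_pdivrMr // -subr_gt0.
  have -> : 2 * N * (r + N) - N * r = N * r + N * N * 2 by ring.
  by rewrite ltr_wpDl ?mulr_ge0 ?mulr_gt0 // ltW.
have vM : x ^t* *m M = v ^t* by rewrite adjmxM herm.
rewrite /qform adjmxB adjmxZ tC mulmxBl vM.
rewrite mulmxBl !mulmxBr -!scalemxAl -!scalemxAr.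
have vx : (v ^t* *m x) 0 0 = 0 by rewrite -vM.
rewrite -(mulmxA _ M x) -/v.
move: vx; rewrite /r /qform /N !mxE => ->; ring.
Qed.

(** Positivity on unit vectors extends to all vectors by homogeneity, so the
    unit vector [x] is in the kernel; its adjoint is then a left null vector. *)
Lemma psd_isotropic_det0 n (M : 'M[C]_n) x :
  M ^t* = M -> (forall y, (y ^t* *m y) 0 0 = 1 -> 0 <= qform M y) ->
  (x ^t* *m x) 0 0 = 1 -> qform M x = 0 -> \det M = 0.
Proof.
move=> herm pos x1 q0; apply/eqP/det0P; exists (x ^t*).
  apply/eqP => x0; move: x1; rewrite x0 mul0mx mxE => /esym/eqP.
  by rewrite oner_eq0.
rewrite -[M]herm -adjmxM psd_isotropic_ker //; first by rewrite trmx0 map_mx0.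
move=> y; have [->|y0] := eqVneq y 0; first by rewrite /qform mulmx0 mxE.
have [a [a0 /pos]] := exists_unit_multiple y0.
by rewrite qform_scale pmulr_rge0 // exprn_gt0 // normr_gt0.
Qed.

Lemma det0_unit_isotropic n (M : 'M[C]_n) : \det M = 0 ->
  exists2 x, (x ^t* *m x) 0 0 = 1 & qform M x = 0.
Proof.
move=> /eqP/det0P[v v0 vM].
have v1 : v ^t* != 0.
  by apply: contraNneq v0 => v1; rewrite -[v]adjmxK v1 trmx0 map_mx0.
have [a [_ a1]] := exists_unit_multiple v1; exists (a *: v ^t*) => //.
by rewrite qform_scale /qform adjmxK vM mul0mx mxE mulr0.
Qed.

End QuadraticForm.

(** * Support function of the numerical range *)

Local Open Scope complex_scope.

Section Support.
Variable R : realType.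

(** The outer normal direction is [e^(- i theta)] rather than [e^(i theta)],
    to match [Re (e^(i theta) A)]. *)
Definition is_support (W : set R[i]) (theta h : R) : Prop :=
  (exists2 w, W w & complex.Re (expi theta * w) = h) /\
  (forall w, W w -> complex.Re (expi theta * w) <= h).

Lemma qform_re_mx n (A : 'M[R[i]]_n) theta x :
  qform (re_mx (expi theta *: A)) x =
    (complex.Re (expi theta * qform A x))%:C.
Proof.
by rewrite /re_mx qformZ qformD qform_adj qformZ ReJ_add mulrC.
Qed.

Lemma re_mx_herm n (M : 'M[R[i]]_n) : (re_mx M) ^t* = re_mx M.
Proof.
rewrite /re_mx adjmxZ; congr (_ *: _); first by rewrite fmorphV rmorph_nat.
have adjmxD (N K : 'M[R[i]]_n) : (N + K) ^t* = N ^t* + K ^t*.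
  by apply/matrixP => i j; rewrite !mxE rmorphD.
by rewrite adjmxD adjmxK addrC.
Qed.

(** The matrix [h - Re (e^(i theta) A)] is positive semidefinite, and its form
    vanishes at a unit vector where the maximum [h] is attained. *)
Lemma NR_generating_support n (A : 'M[R[i]]_n) theta h :
  is_support (numerical_range A) theta h -> NR_generating A h theta = 0.
Proof.
case=> -[_ [x x1 ->] xh] ub; rewrite /NR_generating.
rewrite -opprB -scaleN1r detZ; set M := _ - _.
have qM y : (y ^t* *m y) 0 0 = 1 ->
    qform M y = (h - complex.Re (expi theta * qform A y))%:C.
  move=> y1; rewrite /M qformD qform_scalar y1 mulr1 -scaleN1r qformZ.
  by rewrite qform_re_mx mulN1r [RHS]rmorphB.
rewrite (@psd_isotropic_det0 _ _ M x) ?mulr0 //.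
- rewrite /M adjmxB re_mx_herm; congr (_ - _); apply/matrixP => i j.
  rewrite !mxE eq_sym; case: (i == j); last by rewrite mulr0n rmorph0.
  exact: conjc_real.
- by move=> y y1; rewrite qM // lecR subr_ge0 ub //; exists y.
- by rewrite qM // xh subrr.
Qed.

Lemma NR_generating_root n (A : 'M[R[i]]_n) theta l :
  NR_generating A l theta = 0 ->
  exists2 w, numerical_range A w & complex.Re (expi theta * w) = l.
Proof.
move=> /det0_unit_isotropic[x x1 qx]; exists (qform A x); first by exists x.
apply/eqP; rewrite -subr_eq0; apply/eqP/complexI.
rewrite rmorphB /= -qform_re_mx -[RHS]qx qformD -[- _%:M]scaleN1r; congr (_ + _).
by rewrite qformZ qform_scalar x1 mulr1 mulN1r.
Qed.

(** [P_A (., theta)] is determined by [cos (2 theta)].  So the maximum [h] for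
    [theta], being a root there, is a value of the linear functional for
    [theta'], hence at most [h']; and conversely. *)
Lemma support_eq n (A : 'M[R[i]]_n) P theta theta' h h' :
  is_NR_poly A P -> cos (theta *+ 2) = cos (theta' *+ 2) ->
  is_support (numerical_range A) theta h ->
  is_support (numerical_range A) theta' h' -> h = h'.
Proof.
move=> [_ _ PA].
have le a a' k k' : cos (a *+ 2) = cos (a' *+ 2) ->
    is_support (numerical_range A) a k ->
    is_support (numerical_range A) a' k' -> k <= k'.
  move=> aa' /NR_generating_support; rewrite PA aa' -PA.
  by case/NR_generating_root => w Ww <- [_ ->].
by move=> tt' sh sh'; apply/le_anti/andP; split; [apply: le sh sh'|apply: le sh' sh].
Qed.

(** The linear functional is [X s - Y t] on the unit disk, up to a constant, so
    its maximum is the length of [(X, - Y)], by Cauchy-Schwarz. *)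
Lemma support_elliptical_disk (c : R[i]) (a b p q theta : R) :
  is_support (elliptical_disk c (a +i* b) p q) theta
    (complex.Re (expi theta * c) +
     Num.sqrt ((p * (cos theta * a - sin theta * b)) ^+ 2 +
               (q * (cos theta * b + sin theta * a)) ^+ 2)).
Proof.
set X := p * _; set Y := q * _; set g := Num.sqrt _.
have ReE s t : complex.Re (expi theta * (c + (a +i* b) * ((p * s) +i* (q * t)))) =
    complex.Re (expi theta * c) + (X * s - Y * t).
  by case: c => c1 c2; rewrite /expi; simpc; rewrite /= /X /Y; ring.
have XY0 : 0 <= X ^+ 2 + Y ^+ 2 by rewrite addr_ge0 ?sqr_ge0.
have gg : g ^+ 2 = X ^+ 2 + Y ^+ 2 by rewrite sqr_sqrtr.
split; last first.
  move=> _ [s [t [st ->]]]; rewrite ReE lerD2l.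
  apply: le_trans (ler_norm _) _; rewrite -sqrtr_sqr ler_wsqrtr // -subr_ge0.
  have -> : X ^+ 2 + Y ^+ 2 - (X * s - Y * t) ^+ 2 =
      (X ^+ 2 + Y ^+ 2) * (1 - (s ^+ 2 + t ^+ 2)) + (X * t + Y * s) ^+ 2.
    by ring.
  by rewrite addr_ge0 ?sqr_ge0 ?mulr_ge0 ?subr_ge0.
have [g0|g0] := eqVneq g 0.
  exists c; last by rewrite g0 addr0.
  exists 0, 0; rewrite expr0n addr0 ler01; split=> //.
  by rewrite !mulr0 addr0.
exists (c + (a +i* b) * ((p * (X / g)) +i* (q * (- Y / g)))).
  exists (X / g), (- Y / g); split=> //.
  by rewrite !expr_div_n sqrrN -mulrDl -gg divff ?expf_neq0.
rewrite ReE; congr (_ + _).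
have -> : X * (X / g) - Y * (- Y / g) = (X ^+ 2 + Y ^+ 2) / g by field.
by rewrite -gg expr2 mulfK.
Qed.

(** * Ellipses with the symmetry of the numerical range *)

(** The equality at [theta] and [theta + pi] kills the linear part coming from
    the centre, as it changes sign; the equality at [pi / 4] and [- pi / 4]
    kills the coefficient of [sin (2 theta)] in the square. *)
Lemma squared_support_affine n (A : 'M[R[i]]_n) P (p q : R) :
  is_NR_poly A P -> is_elliptical_disk (numerical_range A) p q ->
  exists x z : R,
    [/\ 0 <= z + x /\ 0 <= z - x, 0 < z,
        perm_eq [:: Num.sqrt (z + x); Num.sqrt (z - x)] [:: p; q] &
        forall theta, is_support (numerical_range A) theta
                        (Num.sqrt (x * cos (theta *+ 2) + z))].
Proof.
move=> PA [p0 q0 qp [c [[a b] [u1 WE]]]].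
have ab : a ^+ 2 + b ^+ 2 = 1.
  by apply: complexI; rewrite (add_Re2_Im2 (a +i* b)) u1 expr1n.
pose X := (p * a) ^+ 2 + (q * b) ^+ 2; pose Y := (p * b) ^+ 2 + (q * a) ^+ 2.
pose g2 theta := (p * (cos theta * a - sin theta * b)) ^+ 2 +
                 (q * (cos theta * b + sin theta * a)) ^+ 2.
have g20 theta : 0 <= g2 theta by rewrite addr_ge0 ?sqr_ge0.
have supp theta : is_support (numerical_range A) theta
    (complex.Re (expi theta * c) + Num.sqrt (g2 theta)).
  by rewrite WE; exact: support_elliptical_disk.
have kc theta : complex.Re (expi theta * c) = 0.
  have cc : cos (theta *+ 2) = cos ((theta + pi) *+ 2) :> R.
    by rewrite mulrnDl cosD2pi.
  have := support_eq PA cc (supp _) (supp _).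
  have -> : g2 (theta + pi) = g2 theta by rewrite /g2 cosDpi sinDpi; ring.
  move/addIr.
  have -> : expi (theta + pi) = - expi theta.
    by rewrite /expi cosDpi sinDpi; simpc.
  by rewrite mulNr raddfN /=; lra.
have suppE theta : is_support (numerical_range A) theta (Num.sqrt (g2 theta)).
  by have := supp theta; rewrite kc add0r.
have cross : a * b * (p ^+ 2 - q ^+ 2) = 0.
  have cc : cos ((pi / 4) *+ 2) = cos (- (pi / 4) *+ 2) :> R.
    by rewrite mulNrn cosN.
  have := support_eq PA cc (suppE _) (suppE _).
  move=> /eqP; rewrite eqr_sqrt // => /eqP gN.
  have cs : 2 * (cos (pi / 4) * sin (pi / 4)) = 1 :> R.
    transitivity (sin (pi / 4 *+ 2) : R); first by rewrite sin_mulr2n; ring.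
    by rewrite (_ : pi / 4 *+ 2 = pi / 2) ?sin_pihalf //; field.
  (* The two values of [g2] differ by [4 cos sin a b (p^2 - q^2)]. *)
  rewrite -[LHS]mul1r -cs.
  apply: (@mulfI _ (- 2)); first by rewrite oppr_eq0 pnatr_eq0.
  rewrite mulr0 -[RHS](subrr (g2 (pi / 4))) {2}gN /g2 cosN sinN; ring.
have g2E theta : g2 theta = (X - Y) / 2 * cos (theta *+ 2) + (X + Y) / 2.
  rewrite cos_mulr2n.
  have s2 : sin theta ^+ 2 = 1 - cos theta ^+ 2 by rewrite -(cos2Dsin2 theta); ring.
  transitivity (cos theta ^+ 2 * X + sin theta ^+ 2 * Y -
      2 * (cos theta * sin theta) * (a * b * (p ^+ 2 - q ^+ 2))).
    by rewrite /g2 /X /Y; ring.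
  by rewrite cross s2; field.
exists ((X - Y) / 2), ((X + Y) / 2).
have -> : (X + Y) / 2 + (X - Y) / 2 = X by field.
have -> : (X + Y) / 2 - (X - Y) / 2 = Y by field.
split.
- by split; rewrite addr_ge0 ?sqr_ge0.
- have -> : X + Y = (p ^+ 2 + q ^+ 2) * (a ^+ 2 + b ^+ 2) by rewrite /X /Y; ring.
  by rewrite ab mulr1 divr_gt0 // ltr_pwDl ?sqr_ge0 ?exprn_gt0.
- have sqrtP : Num.sqrt (p ^+ 2) = p by rewrite sqrtr_sqr gtr0_norm.
  have sqrtQ : Num.sqrt (q ^+ 2) = q by rewrite sqrtr_sqr ger0_norm.
  move/eqP: cross; rewrite !mulf_eq0 subr_eq0 => /orP[/orP[]/eqP e|/eqP e].
  + have XE : X = q ^+ 2 by rewrite -[RHS]mulr1 -ab /X e; ring.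
    have YE : Y = p ^+ 2 by rewrite -[RHS]mulr1 -ab /Y e; ring.
    by rewrite XE YE sqrtP sqrtQ (perm_catC [:: q] [:: p]) perm_refl.
  + have XE : X = p ^+ 2 by rewrite -[RHS]mulr1 -ab /X e; ring.
    have YE : Y = q ^+ 2 by rewrite -[RHS]mulr1 -ab /Y e; ring.
    by rewrite XE YE sqrtP sqrtQ perm_refl.
  + have XE : X = p ^+ 2 by rewrite /X !exprMn -e -mulrDr ab mulr1.
    have YE : Y = q ^+ 2 by rewrite /Y !exprMn e -mulrDr addrC ab mulr1.
    by rewrite XE YE sqrtP sqrtQ perm_refl.
- by move=> theta; rewrite -g2E.
Qed.

(** * The polynomial identity *)

Lemma horner_horner (K : comNzRingType) (P : {poly {poly K}}) (L : {poly K}) t :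
  P.[L].[t] = P.[L.[t]%:P].[t].
Proof.
rewrite [P.[L]]horner_coef [P.[_%:P]]horner_coef !horner_sum.
apply: eq_bigr => i _.
by rewrite !hornerM !horner_exp hornerC.
Qed.

(** For [0 < tau < 1] the value [x tau + z], a proper convex combination of [z]
    and [z + x], is positive; so its square root is a nonzero root of
    [P_A], and the factor [- lambda] present for odd [n] can be cancelled.
    The points [tau = 1 / (k + 2)] are infinitely many of this kind. *)
Lemma NR_poly_root_affine n (A : 'M[R[i]]_n) P (x z : R) :
  is_NR_poly A P -> 0 <= z + x -> 0 < z ->
  (forall theta, is_support (numerical_range A) theta
                   (Num.sqrt (x * cos (theta *+ 2) + z))) ->
  P.[x *: 'X + z%:P] = 0.
Proof.
move=> PA zx z0 supp.
apply: (@poly_inf_roots _ _ (fun k => (k.+2%:R : R)^-1)) => [h h' /invr_inj/eqP|k].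
  by rewrite eqr_nat !eqSS => /eqP.
set tau := _^-1.
have tau0 : 0 < tau by rewrite invr_gt0 ltr0Sn.
have tau1 : tau < 1 by rewrite invf_lt1 ?ltr0Sn // ltr1n.
pose theta := acos tau / 2.
have ct : cos (theta *+ 2) = tau.
  rewrite -mulr_natr mulfVK ?pnatr_eq0 // acosK // in_itv /= (ltW tau1) andbT.
  by apply: le_trans (ltW tau0); rewrite lerN10.
have zeta0 : 0 < x * tau + z.
  have -> : x * tau + z = z * (1 - tau) + (z + x) * tau by ring.
  by rewrite ltr_pwDl ?mulr_gt0 ?mulr_ge0 ?subr_gt0 // ltW.
have [_ _ PAE] := PA.
have := NR_generating_support (supp theta).
rewrite PAE ct sqr_sqrtr; last exact: ltW.
rewrite horner_horner !hornerE -/(eval2 _ _ _) => /eqP.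
rewrite mulf_eq0 !(fmorph_eq0 (real_complex R)) => /orP[|/eqP //].
by case: (odd n); rewrite ?oppr_eq0 ?oner_eq0 // gt_eqF // sqrtr_gt0.
Qed.

End Support.

Theorem theorem6 (R : realType) (n : nat) (A : 'M[R[i]]_n)
    (P : {poly {poly R}}) (p q : R) :
  (2 <= n)%N ->
  reciprocal A ->
  is_NR_poly A P ->
  is_elliptical_disk (numerical_range A) p q ->
  exists x z : R,
    [/\ 0 <= z + x /\ 0 <= z - x,
        perm_eq [:: Num.sqrt (z + x); Num.sqrt (z - x)] [:: p; q],
        exists Q : {poly {poly R}}, P = Q * ('X - (x *: 'X + z%:P)%:P) &
        forall tau : R, eval2 P (x * tau + z) tau = 0].
Proof.
move=> _ _ PA WE.
have [x [z [[zx zNx] z0 perm supp]]] := squared_support_affine PA WE.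
have PL := NR_poly_root_affine PA zx z0 supp.
exists x, z; split=> //; first exact/factor_theorem/rootP.
move=> tau; have := congr1 (horner^~ tau) PL.
by rewrite horner_horner !hornerE.
Qed.
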